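(* For all integers $v\ge t$, the following hold. (1) For $v\le 11$: $g(v,5)\le 66$ (for $v\ge5$). (2) For $v\le 12$: $g(v,4)\le 18$ (for $v\ge4$), $g(v,5)\le 792$ (for $v\ge5$) and $g(v,6)\le 132$ (for $v\ge6$). (3) For $v\le 13$: $g(v,4)\le 234$ (for $v\ge4$). (4) For $v\le 21$: $g(v,4)\le 5040$ (for $v\ge4$). (5) For $v\le 22$: $g(v,5)\le 3696$ (for $v\ge5$) and $g(v,4)\le 18480$ (for $v\ge4$). (6) For $v\le 23$: $g(v,5)\le 85008$ (for $v\ge5$) and $g(v,4)\le 425040$ (for $v\ge4$). (7) For $v\le 24$: $g(v,6)\le 340032$ (for $v\ge6$), $g(v,5)\le 2040192$ (for $v\ge5$) and $g(v,4)\le 10200960$ (for $v\ge4$).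
   Context: For integers $v\ge t\ge 2$, let $[v]=\{0,\dots,v-1\}$, let $\mathcal{S}_v$ be the set of permutations of $[v]$ (bijections $[v]\to[v]$), and let $\mathcal{S}_{v,t}$ be the set of ordered sequences of $t$ distinct elements of $[v]$. A sequence $s=(s_0,\dots,s_{t-1})\in\mathcal{S}_{v,t}$ is covered by $\pi\in\mathcal{S}_v$ if $\pi^{-1}(s_i)<\pi^{-1}(s_{i+1})$ for $0\le i\le t-2$. For a positive integer $\lambda$, a PSCA$(v,t,\lambda)$ is a multiset $X$ of permutations in $\mathcal{S}_v$ such that every sequence in $\mathcal{S}_{v,t}$ is covered by exactly $\lambda$ permutations in $X$ (counted with multiplicity). For $v\ge t\ge2$, $g(v,t)$ denotes the smallest positive integer $\lambda$ such that a PSCA$(v,t,\lambda)$ exists. *)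

(* Defs.v *)
From mathcomp Require Import all_boot all_fingroup all_solvable.
From mathcomp Require Import finmap multiset boolp.
Set Implicit Arguments.
Unset Strict Implicit.
Unset Printing Implicit Defensive.
Local Open Scope nat_scope.
Local Open Scope mset_scope.

Definition dseqs (v t : nat) : {set t.-tuple 'I_v} :=
  [set s : t.-tuple 'I_v | uniq s].

(* [sorted] compares consecutive entries: pi^-1(s_i) < pi^-1(s_(i+1)). *)
Definition covers (v t : nat) (pi : 'S_v) (s : t.-tuple 'I_v) : bool :=
  sorted (fun x y : 'I_v => (pi^-1)%g x < (pi^-1)%g y) s.

(* [X pi] is the multiplicity of pi in X. *)
Definition PSCA (v t lambda : nat) (X : {mset 'S_v}) : Prop :=
  forall s : t.-tuple 'I_v, s \in dseqs v t ->
    \sum_(pi : 'S_v | covers pi s) X pi = lambda.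

Definition has_PSCA (v t : nat) : pred nat :=
  fun lambda => (0 < lambda) && `[< exists X : {mset 'S_v}, PSCA t lambda X >].

Lemma covers_map (v t : nat) (sigma pi : 'S_v) (s : t.-tuple 'I_v) :
  covers pi (map_tuple sigma s) = covers (pi * sigma^-1)%g s.
Proof.
rewrite /covers /= sorted_map; apply: eq_sorted => x y /=.
by rewrite invMg invgK !permM.
Qed.

Lemma dseqs_trans (v t : nat) (s s' : t.-tuple 'I_v) :
  s \in dseqs v t -> s' \in dseqs v t ->
  exists sigma : 'S_v, s' = map_tuple sigma s.
Proof.
rewrite !inE => us us'.
have le_tv : t <= #|'I_v|.
  by rewrite -(size_tuple s) -(card_uniqP us) max_card.
have tr := ntransitive_weak le_tv (Sym_trans 'I_v).
have ds r : uniq (tval r) -> r \in t.-dtuple([set: 'I_v]).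
  by move=> ur; rewrite inE ur; apply/subsetP => x _; rewrite inE.
have [sigma _ ->] := atransP2 tr (ds _ us) (ds _ us').
by exists sigma; apply: val_inj.
Qed.

(* The set of all permutations is always a PSCA. *)
Lemma ex_has_PSCA (v t : nat) : exists lambda, has_PSCA v t lambda.
Proof.
have [s0 s0P|noS] := pickP [in dseqs v t]; last first.
  exists 1; apply/andP; split=> //; apply/asboolP; exists mset0 => s.
  by have := noS s; rewrite inE => ->.
exists #|[pred pi | covers pi s0]|; apply/andP; split.
  have le_tv : t <= v.
    move: s0P; rewrite !inE => /card_uniqP; rewrite size_tuple => <-.
    by rewrite -[leqRHS]card_ord max_card.
  pose s1 : t.-tuple 'I_v := [tuple widen_ord le_tv i | i < t].
  have s1P : s1 \in dseqs v t.
    rewrite inE /= map_inj_uniq ?enum_uniq // => i j /(congr1 val) /= ij.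
    exact: val_inj.
  have c1 : covers 1%g s1.
    rewrite /covers /= sorted_map; have := iota_ltn_sorted 0 t.
    rewrite -val_enum_ord sorted_map; apply: sub_sorted => i j /=.
    by rewrite invg1 !perm1.
  have [sigma s1E] := dseqs_trans s0P s1P.
  apply/card_gt0P; exists (1 * sigma^-1)%g.
  by rewrite inE -covers_map -s1E.
apply/asboolP; exists (seq_mset (enum [set: 'S_v])) => s sP.
have [sigma ->] := dseqs_trans s0P sP.
under eq_bigr do rewrite mset_seqE count_uniq_mem ?enum_uniq// mem_enum inE.
rewrite -[RHS]sum1_card [RHS](reindex_inj (mulIg sigma^-1)%g) /=.
by apply: eq_big => [pi|pi _]; rewrite ?inE ?covers_map.
Qed.

(* The hypotheses t <= v and 2 <= t are left to the uses of g. *)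
Definition g (v t : nat) : nat := ex_minn (ex_has_PSCA v t).

(* Main.v *)
Require Import Defs.
From mathcomp Require Import all_boot all_fingroup.
From mathcomp Require Import finmap multiset boolp zify.
From Stdlib Require PeanoNat.
Set Implicit Arguments.
Unset Strict Implicit.
Unset Printing Implicit Defensive.
Local Open Scope nat_scope.
Local Open Scope mset_scope.

(** Let a group G permute a finite set, and let l list the v points of a G-stable
    subset in some order.  An element h of G reorders these points: x comes
    before y when h x precedes h y in l.  The family of the orders obtained from
    all h in G covers a sequence s exactly as often as some h makes s increasing
    with respect to l; call this number the coverage of s.  Each h makes exactly
    one of the t! arrangements of the entries of s increasing ([sum_coverage]),
    so the coverages of the arrangements add up to |G|.  Hence, if the coverage
    of a sequence never changes when two adjacent entries are exchanged, every
    coverage equals |G| / t!, and g(v, t) <= |G| / t! ([g_mul_fact_leq]).  Keeping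
    only the first few points of l gives the same bound for fewer than v points.

    The bounds are the values |G| / t! for
    - M24 on 24 points (t = 4, 5, 6), its point stabilizer M23 (t = 4, 5) and
      two-point stabilizer M22 (t = 4, 5);
    - M12 on 12 points (t = 5, 6) and its point stabilizer M11 on 11 points (t = 5);
    - PGammaL(3,4) on the 21 points of PG(2,4) (t = 4);
    - PSL(3,3) on the 13 points of PG(2,3) and, on the other 12 points, its point
      stabilizer, of order 432 (t = 4).

    The coverage is constant on G-orbits of sequences.  If the setwise stabilizer
    of every t-set induces all t! permutations of it, exchanging entries does not
    leave the orbit, and every order l works: this happens for M24, M23, for M22
    with t = 4 and for M12 with t = 5.  In the other cases l has to be chosen well.
    For instance M22 induces only even permutations on five points of a hexad, so
    l must put as many of these sets in one parity class as in the other.  In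
    general the exchange of two adjacent entries permutes the orbits, and it is
    enough that corresponding orbits contain equally many increasing sequences
    ([coverage_swap]).

    Two facts about each group are computed.  A stabilizer chain, closed under
    Schreier generators, bounds |G| from above by a product of orbit sizes
    ([card_strong_chain]).  A tree of orbit representatives assigns to each
    sequence a representative of its orbit ([canonP], [canon_leaf]), so that
    increasing sequences can be counted orbit by orbit. *)

(** * From injective rank functions to permutations *)

Lemma sum_count_mem_pred (T : finType) (P : pred T) (s : seq T) :
  \sum_(x | P x) count_mem x s = count P s.
Proof.
elim: s => [|y s IHs] /=; first by rewrite big1.
rewrite big_split /= IHs; congr (_ + _).
rewrite (eq_bigr (fun x => if x == y then 1 else 0)); last first.
  by move=> x _; rewrite eq_sym; case: eqP.
rewrite -big_mkcondr /= (eq_bigl (fun x => P y && (x == y))); last first.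
  by move=> x; case: eqP => [->|_]; rewrite ?andbT ?andbF.
by case: (P y); rewrite ?big_pred1_eq ?big_pred0_eq.
Qed.

Section Standardization.
Variables (v : nat) (f : 'I_v -> nat).
Hypothesis f_inj : injective f.

(** The position of [x] when the points are listed by increasing [f]: it replaces
    [f] by a permutation that orders the points in the same way. *)
Definition rank_below (x : 'I_v) := #|[pred y | f y < f x]|.

Lemma rank_belowP x : rank_below x < v.
Proof.
rewrite -[ltnRHS]card_ord; apply: proper_card; apply/properP; split.
  exact/subsetP.
by exists x; rewrite // inE ltnn.
Qed.

Lemma ltn_rank_below x y : (rank_below x < rank_below y) = (f x < f y).
Proof.
have mono a b : f a < f b -> rank_below a < rank_below b.
  move=> ab; apply: proper_card; apply/properP; split.
    by apply/subsetP => z; rewrite !inE => /ltn_trans; apply.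
  by exists a; rewrite !inE ?ltnn.
case: (ltngtP (f x) (f y)) => [/mono//|/mono yx|/f_inj ->]; last by rewrite ltnn.
by apply/negbTE; rewrite -leqNgt ltnW.
Qed.

Definition rank_fun x := Ordinal (rank_belowP x).

Lemma rank_fun_inj : injective rank_fun.
Proof.
move=> x y /(congr1 val) /= xy; apply: f_inj; apply/eqP.
case: (ltngtP (f x) (f y)) => //; first by rewrite -ltn_rank_below xy ltnn.
by rewrite -ltn_rank_below xy ltnn.
Qed.

(** Inverted, because [covers] compares values of the inverse permutation. *)
Definition standardization : 'S_v := (perm rank_fun_inj)^-1%g.

Lemma covers_standardization t (s : t.-tuple 'I_v) :
  covers standardization s = sorted (fun x y => f x < f y) s.
Proof.
rewrite /covers; apply: eq_sorted => x y.
by rewrite invgK !permE /= ltn_rank_below.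
Qed.

End Standardization.

(** A PSCA may be given by injective rank functions with arbitrary natural values,
    as only the relative order of the ranks of the symbols matters. *)
Lemma PSCA_of_ranks (I : finType) (A : {set I}) v t lambda
    (f : I -> 'I_v -> nat) :
  (forall i, injective (f i)) ->
  (forall s, s \in dseqs v t ->
     #|[set i in A | sorted (fun x y => f i x < f i y) (tval s)]| = lambda) ->
  exists X : {mset 'S_v}, PSCA t lambda X.
Proof.
move=> f_inj f_cov.
exists (seq_mset [seq standardization (f_inj i) | i <- enum A]) => s s_d.
rewrite -(f_cov s s_d); under eq_bigr do rewrite mset_seqE.
rewrite sum_count_mem_pred count_map -size_filter cardE.
rewrite /enum_mem -filter_predI size_filter size_filter.
apply: eq_count => i /=.
by rewrite inE covers_standardization andbC.
Qed.

Lemma g_leq_PSCA (v t lambda : nat) (X : {mset 'S_v}) :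
  0 < lambda -> PSCA t lambda X -> g v t <= lambda.
Proof.
move=> lambda_gt0 X_P; rewrite /g; case: ex_minnP => m _; apply.
by rewrite /has_PSCA lambda_gt0; apply/asboolP; exists X.
Qed.

(** * Permutations as lists of images *)

(** Points are natural numbers.  The default value of [nth] makes [img p] the
    identity beyond the length of [p], so that it is a bijection of the naturals. *)
Definition img (p : seq nat) x := nth x p x.
Definition compose p q := [seq img q x | x <- p].
Definition inverse p := [seq index x p | x <- iota 0 (size p)].
Definition valid n p := perm_eq p (iota 0 n).

Section Permutations.
Variable n : nat.
Implicit Types (p q : seq nat) (h : 'S_n).

Lemma valid_size p : valid n p -> size p = n.
Proof. by move/perm_size; rewrite size_iota. Qed.

Lemma valid_uniq p : valid n p -> uniq p.
Proof. by move/perm_uniq; rewrite iota_uniq. Qed.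

Lemma mem_valid p x : valid n p -> (x \in p) = (x < n).
Proof. by move/perm_mem->; rewrite mem_iota. Qed.

Lemma img_out p x : valid n p -> n <= x -> img p x = x.
Proof. by move=> vp nx; rewrite /img nth_default // valid_size. Qed.

Lemma img_lt p x : valid n p -> (img p x < n) = (x < n).
Proof.
move=> vp; case: (ltnP x n) => xn.
  by rewrite -(mem_valid _ vp) mem_nth // valid_size.
by rewrite img_out // ltnNge xn.
Qed.

Lemma img_inj p : valid n p -> injective (img p).
Proof.
move=> vp x y xy; have := img_lt y vp; rewrite -xy img_lt // => xyn.
move: xy; rewrite /img; case: (ltnP x n) xyn => xn; case: ltnP => // yn _.
  rewrite (set_nth_default y) ?valid_size // => /eqP.
  by rewrite nth_uniq ?valid_size ?(valid_uniq vp) // => /eqP.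
by rewrite !nth_default ?valid_size.
Qed.

Definition ord_img p (i : 'I_n) : 'I_n := insubd i (img p i).

Definition to_perm p : 'S_n :=
  if injectiveP (ord_img p) is ReflectT inj then perm inj else 1%g.

Lemma to_permE p i : valid n p -> to_perm p i = img p i :> nat.
Proof.
move=> vp; have E j : ord_img p j = img p j :> nat.
  by rewrite val_insubd img_lt // ltn_ord.
rewrite /to_perm; case: injectiveP => [inj|[]]; first by rewrite permE E.
by move=> j k /(congr1 val) /=; rewrite !E => /(img_inj vp) /val_inj.
Qed.

(** The action of a permutation extended by the identity to all naturals, which
    spares the range conditions on points. *)
Definition actn h x : nat := if insub x is Some i then val (h i) else x.

Lemma actn_ord h (i : 'I_n) : actn h i = h i.
Proof. by rewrite /actn valK. Qed.

Lemma actn_out h x : n <= x -> actn h x = x.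
Proof. by move=> nx; rewrite /actn insubF // ltnNge nx. Qed.

Lemma actnM h k x : actn (h * k)%g x = actn k (actn h x).
Proof.
case: (ltnP x n) => xn; last by rewrite !actn_out.
by rewrite -[x]/(val (Ordinal xn)) !actn_ord permM.
Qed.

Lemma actn1 x : actn 1%g x = x.
Proof.
case: (ltnP x n) => xn; last by rewrite actn_out.
by rewrite -[x]/(val (Ordinal xn)) actn_ord perm1.
Qed.

Lemma actnK h : cancel (actn h) (actn h^-1%g).
Proof. by move=> x; rewrite -actnM mulgV actn1. Qed.

Lemma actnVK h : cancel (actn h^-1%g) (actn h).
Proof. by move=> x; rewrite -actnM mulVg actn1. Qed.

Lemma actn_inj h : injective (actn h).
Proof. exact: can_inj (actnK h). Qed.

Lemma actn_to_perm p x : valid n p -> actn (to_perm p) x = img p x.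
Proof.
move=> vp; case: (ltnP x n) => xn.
  by rewrite -[x]/(val (Ordinal xn)) actn_ord to_permE.
by rewrite actn_out // img_out.
Qed.

Lemma eq_actn h k : (forall x, actn h x = actn k x) -> h = k.
Proof. by move=> hk; apply/permP => i; apply: ord_inj; rewrite -!actn_ord. Qed.

Lemma validI p : uniq p -> size p = n -> {in p, forall x, x < n} -> valid n p.
Proof.
move=> up sp ltp; have sub : {subset p <= iota 0 n}.
  by move=> x /ltp xn; rewrite mem_iota.
apply: uniq_perm (iota_uniq _ _) _ => //.
by case: (uniq_min_size up sub) => //; rewrite size_iota sp.
Qed.

Lemma valid_compose p q : valid n p -> valid n q -> valid n (compose p q).
Proof.
move=> vp vq; apply: validI; rewrite ?size_map ?valid_size //.
  by rewrite map_inj_uniq ?(valid_uniq vp) //; exact: img_inj vq.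
by move=> _ /mapP[x xp ->]; rewrite img_lt // -(mem_valid _ vp).
Qed.

Lemma valid_iota : valid n (iota 0 n). Proof. exact: perm_refl. Qed.

Lemma img_compose p q x : valid n p -> valid n q -> img (compose p q) x = img q (img p x).
Proof.
move=> vp vq; rewrite /img; case: (ltnP x n) => xn.
  by rewrite (nth_map x) ?valid_size // /img.
rewrite [nth x p x]nth_default ?valid_size //.
by rewrite !nth_default ?size_map ?valid_size.
Qed.

Lemma to_perm_compose p q : valid n p -> valid n q ->
  to_perm (compose p q) = (to_perm p * to_perm q)%g.
Proof.
move=> vp vq; apply: eq_actn => x.
by rewrite actnM !actn_to_perm ?valid_compose // img_compose.
Qed.

Lemma to_perm_iota : to_perm (iota 0 n) = 1%g.
Proof.
apply: eq_actn => x; rewrite actn1 actn_to_perm ?valid_iota // /img.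
case: (ltnP x n) => xn; first by rewrite nth_iota.
by rewrite nth_default ?size_iota.
Qed.

Lemma img_inverse p x : valid n p -> img (inverse p) (img p x) = x.
Proof.
move=> vp; rewrite /inverse valid_size //; case: (ltnP x n) => xn.
  rewrite /img (nth_map 0) ?size_iota ?[nth x p x < n]img_lt //.
  rewrite nth_iota ?[nth x p x < n]img_lt // add0n.
  by rewrite index_uniq ?valid_size ?(valid_uniq vp).
by rewrite (img_out vp) // /img nth_default // size_map size_iota.
Qed.

Lemma valid_inverse p : valid n p -> valid n (inverse p).
Proof.
move=> vp; rewrite /inverse valid_size //.
have inj : {in iota 0 n &, injective (index^~ p)}.
  by move=> x y; rewrite !mem_iota /= -!(mem_valid _ vp) => xp yp; apply: index_inj.
apply: validI; rewrite ?map_inj_in_uniq ?iota_uniq ?size_map ?size_iota //.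
move=> _ /mapP[x xn ->]; rewrite -(valid_size vp) index_mem.
by rewrite (mem_valid _ vp); move: xn; rewrite mem_iota.
Qed.

Lemma to_perm_inverse p : valid n p -> to_perm (inverse p) = (to_perm p)^-1%g.
Proof.
move=> vp; apply: (mulgI (to_perm p)); rewrite mulgV; apply: eq_actn => x.
by rewrite actnM !actn_to_perm ?valid_inverse // img_inverse // actn1.
Qed.

End Permutations.
Arguments to_perm n p : clear implicits.

(** * Stabilizer chains *)

(** Schreier's lemma as a bound: H * T contains 1 and is closed under right
    multiplication by S, hence contains the group that S generates. *)
Lemma card_gen_leq (gT : finGroupType) (H : {group gT}) (S T : {set gT}) :
  1%g \in T -> (forall t s, t \in T -> s \in S -> (t * s)%g \in (H * T)%g) ->
  #|<<S>>%g| <= #|H| * #|T|.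
Proof.
move=> T1 TS; have HT x : x \in <<S>>%g -> x \in (H * T)%g.
  case/gen_prodgP => m [c cS ->]; elim: m c cS => [|m IHm] c cS.
    by rewrite big_ord0 -[1%g]mulg1 mem_mulg.
  rewrite big_ord_recr /=.
  have /mulsgP[h t hH tT ->] := IHm _ (fun i => cS (widen_ord (leqnSn m) i)).
  rewrite -mulgA -[H : {set _}]mulGid -mulgA mem_mulg //.
  exact: TS (cS _).
apply: leq_trans (subset_leq_card (introT subsetP HT)) _.
rewrite -[_ * #|T|]cardsX; apply: leq_trans (leq_imset_card (fun x => x.1 * x.2)%g _).
apply/subset_leq_card/subsetP => _ /mulsgP[h t hH tT ->].
by apply/imsetP; exists (h, t); rewrite // inE hH.
Qed.

(** Indexed by the points: the entry at [x] is a permutation that takes [x] to the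
    base point, if [x] is in its orbit. *)
Definition transversal := seq (option (seq nat)).

(** One step of the orbit enumeration.  The state is a queue of points to be
    expanded, each with its permutation to the base point, and the transversal.
    Going backwards along [s] from [y] keeps permutations directed to the base. *)
Definition extend y p (st : seq (nat * seq nat) * transversal) s :=
  let x := img (inverse s) y in
  if nth None st.2 x is Some _ then st
  else let q := compose s p in (rcons st.1 (x, q), set_nth None st.2 x (Some q)).

Fixpoint grow S fuel (st : seq (nat * seq nat) * transversal) : transversal :=
  match fuel, st with
  | fuel'.+1, ((y, p) :: queue, T) => grow S fuel' (foldl (extend y p) (queue, T) S)
  | _, _ => st.2
  end.

Definition orbit_transversal n (S : seq (seq nat)) b : transversal :=
  let e := iota 0 n in
  grow S n ([:: (b, e)], set_nth None [::] b (Some e)).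

Definition generated n (S : seq (seq nat)) : {group 'S_n} :=
  <<[set h in [seq to_perm n s | s <- S]]>>%G.

Lemma mem_generated n (S : seq (seq nat)) s : s \in S -> to_perm n s \in generated n S.
Proof. by move=> sS; apply: mem_gen; rewrite inE map_f. Qed.

Lemma generatedS n (S1 S2 : seq (seq nat)) :
  {subset S1 <= S2} -> generated n S1 \subset generated n S2.
Proof.
move=> S12; apply: genS; apply/subsetP => h.
by rewrite !inE => /mapP[s /S12 sS ->]; rewrite map_f.
Qed.

Lemma nth_set_nth_None (T : transversal) x q y p :
  nth None (set_nth None T x (Some q)) y = Some p ->
  y = x /\ p = q \/ nth None T y = Some p.
Proof. by rewrite nth_set_nth /=; case: eqP => [-> [->]|_ ->]; [left|right]. Qed.

Section OrbitTransversal.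
Variables (n : nat) (S : seq (seq nat)) (b : nat).
Hypothesis S_valid : all (valid n) S.

Definition moves_to_base x p :=
  [/\ valid n p, to_perm n p \in generated n S & img p x = b].

Definition sound_state (st : seq (nat * seq nat) * transversal) :=
  (forall x p, (x, p) \in st.1 -> moves_to_base x p) /\
  (forall x p, nth None st.2 x = Some p -> moves_to_base x p).

Lemma extendP y p st s :
  moves_to_base y p -> s \in S -> sound_state st -> sound_state (extend y p st s).
Proof.
case=> vp Gp pb sS [Q_P T_P]; have vs := allP S_valid s sS.
have new : moves_to_base (img (inverse s) y) (compose s p).
  split; first exact: valid_compose.
    by rewrite to_perm_compose // groupM // mem_generated.
  rewrite (img_compose _ vs vp) -(actn_to_perm _ vs) -(actn_to_perm _ (valid_inverse vs)).
  by rewrite to_perm_inverse // actnVK.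
rewrite /extend; case E: nth => [//|]; split=> x q /=.
  by rewrite mem_rcons inE => /predU1P[[-> ->]|/Q_P].
by case/nth_set_nth_None => [[-> ->]|/T_P].
Qed.

Lemma growP fuel st x p :
  sound_state st -> nth None (grow S fuel st) x = Some p -> moves_to_base x p.
Proof.
elim: fuel st => [|fuel IH] [[|[y q] Q] T] [Q_P T_P] //=; try exact: T_P.
apply: IH; have yq : moves_to_base y q by apply: Q_P; rewrite mem_head.
have : sound_state (Q, T) by split=> // z r zr; apply: Q_P; rewrite inE zr orbT.
suff fold S' st : {subset S' <= S} -> sound_state st ->
  sound_state (foldl (extend y q) st S') by exact: fold.
elim: S' st => //= s S' IHS st S'S st_P.
apply: IHS => [z zS'|]; first by apply: S'S; rewrite inE zS' orbT.
by apply: extendP => //; apply: S'S; rewrite mem_head.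
Qed.

Lemma orbit_transversalP x p :
  nth None (orbit_transversal n S b) x = Some p -> moves_to_base x p.
Proof.
have base : moves_to_base b (iota 0 n).
  split; [exact: valid_iota | by rewrite to_perm_iota group1 |].
  by rewrite -(actn_to_perm _ (valid_iota n)) to_perm_iota actn1.
apply: growP; split=> {}x {}p /=; first by rewrite inE => /eqP[-> ->].
by case/nth_set_nth_None => [[-> ->]|] //; rewrite nth_nil.
Qed.

End OrbitTransversal.

(** A stabilizer chain: at each level a base point and the generators that are
    added to those of the deeper levels, which fix this base point. *)
Definition chain := seq (nat * seq (seq nat)).

Definition strong_gens (c : chain) := flatten (unzip2 c).

Fixpoint transversals n (c : chain) : seq (nat * transversal) :=
  if c is (b, _) :: c' then
    (b, orbit_transversal n (strong_gens c) b) :: transversals n c'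
  else [::].

(** Reduces [p] to the identity by elements of the transversals, deepest last;
    success expresses [p] as a product of strong generators and inverses. *)
Fixpoint sifts n (tr : seq (nat * transversal)) (p : seq nat) : bool :=
  if tr is (b, T) :: tr' then
    if nth None T (img p b) is Some q then sifts n tr' (compose p q) else false
  else p == iota 0 n.

(** With p the entry of the transversal at x and q the entry at s x, the Schreier
    generator p^-1 s q of the stabilizer of the base point has to sift through the
    deeper levels. *)
Fixpoint closed_chain n (c : chain) (tr : seq (nat * transversal)) : bool :=
  match c, tr with
  | (b, _) :: c', (_, T) :: tr' =>
    [&& size T <= n, nth None T b == Some (iota 0 n), closed_chain n c' tr' &
     all (fun x => if nth None T x is Some p then
       let p' := inverse p in
       all (fun s => if nth None T (img s x) is Some q
                     then sifts n tr' (compose (compose p' s) q) else false)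
           (strong_gens c) else true) (iota 0 n)]
  | _, _ => true
  end.

Definition orbit_size (T : transversal) := count isSome T.

Definition orbit_sizes n c := [seq orbit_size bT.2 | bT <- transversals n c].

Definition strong_chain n c :=
  all (valid n) (strong_gens c) && closed_chain n c (transversals n c).

Lemma strong_gens_behead bS c : {subset strong_gens c <= strong_gens (bS :: c)}.
Proof. by move=> s sc; rewrite /strong_gens /= mem_cat sc orbT. Qed.

Lemma siftsP n c p : all (valid n) (strong_gens c) -> valid n p ->
  sifts n (transversals n c) p -> to_perm n p \in generated n (strong_gens c).
Proof.
elim: c p => [|[b S] c IHc] p vS vp /=.
  by move/eqP->; rewrite to_perm_iota group1.
case E: nth => [q|] // sq.
have [vq Gq _] := orbit_transversalP vS E.
rewrite -(mulgK (to_perm n q) (to_perm n p)) groupM ?groupV // -to_perm_compose //.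
apply: (subsetP (generatedS _ (@strong_gens_behead (b, S) c))).
apply: IHc => //; last exact: valid_compose.
by apply/allP => s /strong_gens_behead sc; apply: (allP vS); apply: sc.
Qed.

Lemma strong_chain_behead n bS c : strong_chain n (bS :: c) -> strong_chain n c.
Proof.
case: bS => b S /andP[vS /= /and4P[_ _ cc _]]; apply/andP; split=> //.
by apply/allP => s /strong_gens_behead sc; apply: (allP vS); apply: sc.
Qed.

Lemma strong_chain_drop n k c : strong_chain n c -> strong_chain n (drop k c).
Proof.
elim: c k => [|bS c IHc] [|k] //= /strong_chain_behead; exact: IHc.
Qed.

(** At each level [card_gen_leq] is applied to H, the group of the deeper levels,
    and to the inverses of the entries of the transversal. *)
Lemma card_strong_chain n c : strong_chain n c ->
  #|generated n (strong_gens c)| <= \prod_(m <- orbit_sizes n c) m.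
Proof.
elim: c => [|[b S] c IHc] sc.
  rewrite /orbit_sizes big_nil -[1](cards1 (1%g : 'S_n)) /generated.
  apply: subset_leq_card; rewrite gen_subG; apply/subsetP => h.
  by rewrite inE.
have {}IHc := IHc (strong_chain_behead sc).
have sc' := strong_chain_behead sc.
case/andP: sc => vS /= /and4P[].
set S1 := strong_gens _ in vS *; set T := orbit_transversal n S1 b.
move=> sT /eqP Tb _ /allP closedT; rewrite /orbit_sizes /= big_cons mulnC -/T.
pose U := [set h in [seq (to_perm n p)^-1%g | p <- pmap id T]].
have TU x p : nth None T x = Some p -> (to_perm n p)^-1%g \in U.
  move=> Tx; rewrite inE; apply/mapP; exists p => //.
  rewrite mem_pmap map_id -Tx mem_nth // ltnNge.
  by apply/negP => /(nth_default None); rewrite Tx.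
have leU : #|U| <= orbit_size T.
  rewrite cardsE; apply: leq_trans (card_size _) _.
  by rewrite size_map size_pmap.
apply: leq_trans (leq_mul IHc leU).
apply: card_gen_leq => [|h k].
  by rewrite -invg1 -to_perm_iota (TU b).
rewrite !inE => /mapP[p + ->] /mapP[s sS ->].
rewrite mem_pmap map_id => /(nthP None)[x xT Tx].
have := closedT x; rewrite Tx mem_iota (leq_trans xT sT) => /(_ isT) /allP /(_ s sS).
case Tsx: nth => [q|] // siftq.
have [[vp _ _] [vq _ _]] := (orbit_transversalP vS Tx, orbit_transversalP vS Tsx).
have vs := allP vS s sS.
rewrite -(mulgK (to_perm n q) (_ * to_perm n s)%g) mem_mulg ?(TU _ _ Tsx) //.
rewrite -to_perm_inverse // -!to_perm_compose ?valid_compose ?valid_inverse //.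
apply: siftsP siftq; last by rewrite !valid_compose ?valid_inverse.
by case/andP: sc'.
Qed.

(** * Covering counts and exchanges of adjacent entries *)

(** Exchanges the entries at [i] and [i.+1]; the identity if there are none. *)
Fixpoint swap (A : Type) i (s : seq A) :=
  match i, s with
  | 0, x :: y :: s' => y :: x :: s'
  | i'.+1, x :: s' => x :: swap i' s'
  | _, _ => s
  end.

Lemma map_swap (A B : Type) (f : A -> B) i s : map f (swap i s) = swap i (map f s).
Proof. by elim: i s => [[|x [|y s]]|i IHi [|x s]] //=; rewrite IHi. Qed.

Lemma swapK (A : Type) i : involutive (@swap A i).
Proof. by elim: i => [[|x [|y s]]|i IHi [|x s]] //=; rewrite IHi. Qed.

Lemma size_swap (A : Type) i (s : seq A) : size (swap i s) = size s.
Proof. by elim: i s => [[|x [|y s]]|i IHi [|x s]] //=; rewrite IHi. Qed.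

Lemma swap_large (A : Type) i (s : seq A) : (size s).-1 <= i -> swap i s = s.
Proof.
elim: i s => [[|x [|y s]]|i IHi [|x s]] //= si; rewrite IHi //.
by rewrite -subn1 leq_subLR.
Qed.

Lemma swap_cat (A : Type) (s1 s2 : seq A) x y :
  swap (size s1) (s1 ++ x :: y :: s2) = s1 ++ y :: x :: s2.
Proof. by elim: s1 => //= z s1 ->. Qed.

Lemma perm_swap (A : eqType) i (s : seq A) : perm_eq (swap i s) s.
Proof.
elim: i s => [[|x [|y s]]|i IHi [|x s]] //=; last by rewrite perm_cons.
by rewrite -(cat1s y) -(cat1s x s) perm_catCA.
Qed.

(** Any rearrangement is a product of exchanges of adjacent entries. *)
Lemma eq_perm_swap (A : eqType) (B : Type) (f : seq A -> B) t :
  (forall i s, size s = t -> f (swap i s) = f s) ->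
  forall s s', size s = t -> perm_eq s s' -> f s = f s'.
Proof.
move=> f_swap; have front s0 s1 s2 x : size (s0 ++ s1 ++ x :: s2) = t ->
    f (s0 ++ s1 ++ x :: s2) = f (s0 ++ x :: s1 ++ s2).
  elim/last_ind: s1 s2 => [//|s1 y IHs] s2 sz.
  rewrite cat_rcons catA -(swap_cat (s0 ++ s1) s2 x y) f_swap.
    rewrite -catA IHs ?cat_rcons //.
    by rewrite -sz !size_cat size_rcons /= !addnS.
  by rewrite -sz !size_cat size_rcons /= !addnS addnA.
suff H s s' s0 : size (s0 ++ s) = t -> perm_eq s s' -> f (s0 ++ s) = f (s0 ++ s').
  by move=> s s'; exact: (H s s' [::]).
elim: s' s s0 => [|x s' IHs] s s0 sz ss'; first by rewrite (perm_nilP ss').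
have /splitPr sx : x \in s by rewrite (perm_mem ss') mem_head.
case: s / sx sz ss' => s1 s2 sz ss'.
rewrite front // -cat_rcons (IHs (s1 ++ s2)) ?cat_rcons //.
  by rewrite -sz !size_cat /= !size_cat !addnS.
by move: ss'; rewrite -(cat1s x s2) perm_catCA /= perm_cons.
Qed.

(** For a duplicate-free [l], the [t]-subsequences of [l] are the sequences of [t]
    points that are increasing in the order [l]. *)
Fixpoint tsubs (A : Type) t (l : seq A) : seq (seq A) :=
  match t, l with
  | 0, _ => [:: [::]]
  | t'.+1, x :: l' => map (cons x) (tsubs t' l') ++ tsubs t l'
  | _, _ => [::]
  end.

Lemma mem_tsubs (A : eqType) t (l u : seq A) :
  (u \in tsubs t l) = (size u == t) && subseq u l.
Proof.
elim: l t u => [|x l IHl] [|t] [|y u] /=; rewrite ?inE ?andbF //.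
  by rewrite mem_cat IHl orbF; apply/negbTE/mapP => -[].
rewrite mem_cat IHl eqSS; case: (y =P x) => [->|yx].
  rewrite mem_map => [|? ? [] //]; rewrite {}IHl.
  by case: eqP => //= _; apply: orb_idr => /cons_subseq.
by rewrite orb_idl // => /mapP[u' _ [/yx]].
Qed.

Lemma tsubs_uniq (A : eqType) t (l : seq A) : uniq l -> uniq (tsubs t l).
Proof.
elim: l t => [|x l IHl] [|t] //= /andP[xl ul].
have cons_inj : injective (cons x) by move=> ? ? [].
rewrite cat_uniq (map_inj_uniq cons_inj) !IHl // andbT.
apply/hasPn => u; rewrite mem_tsubs => /andP[_ /mem_subseq ul'].
by apply/negP => /mapP[u' _ uE]; case/negP: xl; apply: ul'; rewrite uE mem_head.
Qed.

Definition ordered_in (l s : seq nat) := sorted (fun x y => index x l < index y l) s.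

Lemma ordered_in_subseq l u : uniq l -> {subset u <= l} ->
  ordered_in l u = subseq u l.
Proof.
move=> ul u_l; have tr : transitive (fun x y => index x l < index y l).
  by move=> y x z; apply: ltn_trans.
have ord_l : sorted (fun x y => index x l < index y l) l.
  apply/(sortedP 0) => i il; rewrite !index_uniq //; exact: ltnW.
apply/idP/idP => [ord_u|]; last by move/subseq_sorted; apply.
have -> : u = [seq x <- l | x \in u]; last exact: filter_subseq.
apply: (irr_sorted_eq tr) => // [x||x]; first exact: ltnn.
  exact: sorted_filter.
by rewrite mem_filter andb_idr // => /u_l.
Qed.

Section Counting.
Variables (n t : nat) (G : {group 'S_n}) (l : seq nat).
Hypotheses (l_uniq : uniq l)
  (G_l : forall h x, h \in G -> x \in l -> actn h x \in l).

(** The size of a coset of the stabilizer of [s] if [u] is in the orbit of [s], and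
    0 otherwise. *)
Definition moving (s u : seq nat) := #|[set h in G | map (actn h) s == u]|.
Definition coverage (s : seq nat) := #|[set h in G | ordered_in l (map (actn h) s)]|.

Lemma moving_act s u h : h \in G -> moving s (map (actn h) u) = moving s u.
Proof.
move=> hG; rewrite /moving -[RHS](card_imset _ (mulIg h)); congr #|pred_of_set _|.
apply/setP => k; rewrite inE; apply/andP/imsetP => [[kG /eqP sk]|[{}k + ->]].
  exists (k * h^-1)%g; last by rewrite mulgKV.
  rewrite inE groupM ?groupV //=; apply/eqP.
  apply: (inj_map (@actn_inj _ h)); rewrite -sk -map_comp; apply: eq_map => x /=.
  by rewrite -actnM mulgKV.
rewrite inE => /andP[kG /eqP <-]; rewrite groupM // -map_comp; split=> //.
by apply/eqP/eq_map => x /=; rewrite actnM.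
Qed.

Lemma moving_swap s u i : moving (swap i s) u = moving s (swap i u).
Proof.
congr #|pred_of_set _|; apply/setP => h; rewrite !inE map_swap.
by congr (_ && _); rewrite -(inj_eq (inv_inj (@swapK _ i))) swapK.
Qed.

Lemma coverageE s : size s = t -> {subset s <= l} ->
  coverage s = \sum_(u <- tsubs t l) moving s u.
Proof.
move=> st sl; pose C := [set h in G | ordered_in l (map (actn h) s)].
have -> : coverage s = \sum_(h in C) 1 by rewrite sum1_card.
rewrite (eq_bigr (fun h => count_mem (map (actn h) s) (tsubs t l))) => [|h]; last first.
  rewrite inE => /andP[hG]; rewrite ordered_in_subseq // => [hs|x /mapP[y /sl yl ->]].
    by rewrite count_uniq_mem ?tsubs_uniq // mem_tsubs size_map st eqxx hs.
  exact: G_l.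
under eq_bigr do rewrite -sum1_count.
rewrite big_mkcond /= (eq_bigr (fun h => \sum_(u <- tsubs t l)
  (if (h \in G) && (map (actn h) s == u) then 1 else 0))) => [|h _].
  by rewrite exchange_big; apply: eq_bigr => u _; rewrite -big_mkcond sum1dep_card.
rewrite -big_mkcond /= /C inE; case hG: (h \in G) => /=; last by rewrite big_pred0_eq.
case: ifP => no; first by apply: eq_bigl => u; rewrite eq_sym.
rewrite big_hasC //; apply/hasPn => u.
rewrite mem_tsubs => /andP[_ +]; apply: contraTN => /eqP <-; apply/negPf.
move: no; rewrite ordered_in_subseq // => x /mapP[y /sl yl ->].
exact: G_l.
Qed.

Section Balance.
Variables (canon : seq nat -> seq nat) (R : seq (seq nat)).
Hypotheses (canonP : forall s, exists2 h, h \in G & canon s = map (actn h) s)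
  (R_uniq : uniq R)
  (canonR : forall u, u \in tsubs t l -> canon u \in R).

Definition weight r := count (fun u => canon u == r) (tsubs t l).

Lemma coverage_canon s : size s = t -> {subset s <= l} ->
  coverage s = \sum_(r <- R) weight r * moving s r.
Proof.
move=> st sl; rewrite coverageE //.
have -> : \sum_(u <- tsubs t l) moving s u
        = \sum_(u <- tsubs t l) \sum_(r <- R | r == canon u) moving s r.
  rewrite big_seq [RHS]big_seq; apply: eq_bigr => u ul.
  have [h hG hu] := canonP u.
  rewrite -(moving_act s u hG) -hu (big_rem (canon u)) /= ?eqxx ?canonR //.
  rewrite big_seq_cond big1 ?addn0 // => r.
  by rewrite mem_rem_uniq // inE => /andP[/andP[/negbTE ->]].
under eq_bigr do rewrite big_mkcond /=.
rewrite exchange_big; apply: eq_bigr => r _ /=.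
rewrite -big_mkcond /= /weight -sum1_count big_distrl /=.
by under eq_bigl do rewrite eq_sym; apply: eq_bigr => u _; rewrite mul1n.
Qed.

(** The exchange moves from [s] to the orbit representatives, which it permutes
    through [canon]; the sum of [coverage_canon] is then only reindexed. *)
Lemma coverage_swap i s : size s = t -> {subset s <= l} ->
  perm_eq [seq canon (swap i r) | r <- R] R ->
  {in R, forall r, weight (canon (swap i r)) = weight r} ->
  coverage (swap i s) = coverage s.
Proof.
move=> st sl R_perm R_w; rewrite !coverage_canon ?size_swap //; last first.
  by move=> x; rewrite (perm_mem (perm_swap i s)); apply: sl.
rewrite -[RHS](perm_big _ R_perm) big_map /= big_seq [RHS]big_seq.
apply: eq_bigr => r rR; rewrite R_w // moving_swap.
by have [h hG ->] := canonP (swap i r); rewrite moving_act.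
Qed.

End Balance.

(** Each [h] makes exactly one arrangement of [s] increasing: the entries sorted by
    the position of their images in [l]. *)
Lemma sum_coverage s : uniq s -> {subset s <= l} ->
  \sum_(s' <- permutations s) coverage s' = #|G|.
Proof.
move=> us sl; rewrite -sum1_card.
under eq_bigr do rewrite /coverage -sum1dep_card big_mkcondr /=.
rewrite exchange_big /=; apply: eq_bigr => h hG; rewrite -big_mkcond /=.
pose le x y := index (actn h x) l <= index (actn h y) l.
have tot : total le by move=> x y; apply: leq_total.
have tr : transitive le by move=> y x z; apply: leq_trans.
have inj : {in s &, injective (fun x => index (actn h x) l)}.
  move=> x y xs ys E; apply: (@actn_inj _ h).
  by rewrite -(nth_index 0 (G_l hG (sl x xs))) E nth_index // G_l // sl.
have ordE s' : s' \in permutations s ->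
    ordered_in l (map (actn h) s') = (sort le s == s').
  rewrite mem_permutations => s's.
  rewrite /ordered_in sorted_map.
  rewrite -[sorted _ _]/(sorted (relpre (fun x => index (actn h x) l) ltn) s') -sorted_map.
  rewrite ltn_sorted_uniq_leq sorted_map (perm_uniq (perm_map _ s's)).
  rewrite (map_inj_in_uniq inj) us /=; apply/idP/eqP => [ord|<-]; last exact: sort_sorted.
  apply: (@sorted_eq_in _ le) => //; last by rewrite perm_sort perm_sym.
  - by move=> x y z _ _ _; apply: tr.
  - move=> x y; rewrite !mem_sort => xs ys xy.
    by apply: (inj x y xs ys); apply/eqP; rewrite eqn_leq; exact: xy.
  - exact: sort_sorted.
rewrite sum1_count (@eq_in_count _ _ (pred1 (sort le s))) => [|s' /ordE ->].
  by rewrite count_uniq_mem ?permutations_uniq // mem_permutations perm_sort perm_refl.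
by rewrite eq_sym.
Qed.

End Counting.

(** * Orbit representatives of sequences *)

(** A tree that classifies sequences entry by entry.  The path to a node is a
    prefix of a representative; [Node] carries group elements that fix this prefix,
    and one child for each of their orbits on the other points, labelled by the
    representative of the orbit. *)
Inductive tree := Leaf | Node of seq (seq nat) & seq (nat * tree).

(** Chooses the branch whose transversal contains the first entry [x], moves [x] to
    the representative, and continues with the images of the other entries. *)
Fixpoint follow (br : seq (transversal * (seq nat -> seq nat))) x s :=
  if br is (T, f) :: br' then
    if nth None T x is Some p then img p x :: f (map (img p) s) else follow br' x s
  else x :: s.

(** The representative of the orbit of a sequence of length [t].  The transversals
    are bound outside the function of the sequence, so that they are computed once
    for all the sequences to which [canon n t T] is applied. *)
Fixpoint canon n t (T : tree) : seq nat -> seq nat :=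
  match t, T with
  | t'.+1, Node gs ch =>
    let br := [seq (orbit_transversal n gs c.1, canon n t' c.2) | c <- ch] in
    fun s => if s is x :: s' then follow br x s' else s
  | _, _ => id
  end.

Fixpoint leaves t (T : tree) : seq (seq nat) :=
  match t, T with
  | t'.+1, Node _ ch => flatten [seq map (cons c.1) (leaves t' c.2) | c <- ch]
  | _, _ => [:: [::]]
  end.

(** The generators at each node belong to the group, fix the prefix, and have
    orbits that exhaust the points of [l] outside the prefix. *)
Fixpoint is_orbit_tree n (tr : seq (nat * transversal)) l t (T : tree) (pre : seq nat) :=
  match t, T with
  | 0, _ => true
  | t'.+1, Node gs ch =>
    let Ts := [seq orbit_transversal n gs c.1 | c <- ch] in
    [&& all (fun s => [&& valid n s, sifts n tr s & all (fun x => img s x == x) pre]) gs,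
        all (fun x => (x \in pre) || has (fun T => isSome (nth None T x)) Ts) l
      & all (fun c => is_orbit_tree n tr l t' c.2 (rcons pre c.1)) ch]
  | _, _ => false
  end.

Lemma followP n t gs ch x s :
  let br := [seq (orbit_transversal n gs c.1, canon n t c.2) | c <- ch] in
  (exists i p, let c := nth (0, Leaf) ch i in
    [/\ i < size ch, nth None (orbit_transversal n gs c.1) x = Some p
      & follow br x s = img p x :: canon n t c.2 (map (img p) s)])
  \/ (~~ has (fun T => isSome (nth None T x)) (unzip1 br) /\ follow br x s = x :: s).
Proof.
elim: ch => [|c ch IHch] /=; first by right.
case E: nth => [p|] /=; first by left; exists 0, p.
case: IHch => [[i [p [ich Ei fi]]]|]; last by right.
by left; exists i.+1, p.
Qed.

Lemma generated_fix n S x h : all (valid n) S -> all (fun s => img s x == x) S ->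
  h \in generated n S -> actn h x = x.
Proof.
move=> vS fS /gen_prodgP[m [f fS' ->]].
apply: (big_ind (fun h : 'S_n => actn h x = x)); first exact: actn1.
  by move=> h1 h2 h1x h2x; rewrite actnM h1x.
move=> i _; have := fS' i; rewrite inE => /mapP[s sS ->].
by rewrite actn_to_perm ?(allP vS) //; apply/eqP/(allP fS).
Qed.

Section Tree.
Variables (n : nat) (c : chain) (l : seq nat).
Hypothesis c_valid : all (valid n) (strong_gens c).
Let G := generated n (strong_gens c).
Let tr := transversals n c.

Lemma is_orbit_treeP t gs ch pre i x p : let ci := nth (0, Leaf) ch i in
  is_orbit_tree n tr l t.+1 (Node gs ch) pre -> i < size ch ->
  nth None (orbit_transversal n gs ci.1) x = Some p ->
  [/\ is_orbit_tree n tr l t ci.2 (rcons pre ci.1), to_perm n p \in G,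
      valid n p, img p x = ci.1 & {in pre, forall y, actn (to_perm n p) y = y}].
Proof.
move=> ci /= /and3P[S_ok _ /(all_nthP (0, Leaf)) ch_ok] ich Tx.
have vS : all (valid n) gs by apply: sub_all S_ok => s /and3P[].
have [vp Sp px] := orbit_transversalP vS Tx.
split=> // [||y ypre]; first exact: ch_ok.
- apply: (subsetP _ _ Sp); rewrite gen_subG; apply/subsetP => h.
  rewrite inE => /mapP[s sS ->]; have /and3P[vs ss _] := allP S_ok s sS.
  exact: siftsP.
apply: generated_fix vS _ Sp; apply/allP => s sS.
by have /and3P[_ _ /allP] := allP S_ok s sS; apply.
Qed.

(** The element found for the tail of the sequence fixes the prefix together with
    the new representative, so it does not disturb the entries already moved. *)
Lemma canonP t T pre s : is_orbit_tree n tr l t T pre ->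
  exists2 h, h \in G & {in pre, forall x, actn h x = x} /\ canon n t T s = map (actn h) s.
Proof.
have id_ok s' : exists2 h, h \in G & {in pre, forall x, actn h x = x} /\ s' = map (actn h) s'.
  exists 1%g; first exact: group1.
  by split=> [x _|]; [exact: actn1 | rewrite (eq_map (@actn1 _)) map_id].
elim: t T pre s id_ok => [|t IHt] [|gs ch] pre [|x s] id_ok ok //=.
case: (followP n t gs ch x s) => [[i [p [ich Tx ->]]]|[_ ->]]; last exact: id_ok.
have [ok' Gp vp px pre_p] := is_orbit_treeP ok ich Tx.
case: (IHt _ _ (map (img p) s) _ ok') => [s'|h hG [pre_h ->]].
  exists 1%g; first exact: group1.
  by split=> [y _|]; [exact: actn1 | rewrite (eq_map (@actn1 _)) map_id].
exists (to_perm n p * h)%g; first exact: groupM.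
split=> [y ypre|]; first by rewrite actnM pre_p // pre_h // mem_rcons inE ypre orbT.
rewrite /= actnM actn_to_perm // px pre_h ?mem_rcons ?mem_head //; congr (_ :: _).
by rewrite -map_comp; apply: eq_map => y /=; rewrite actnM actn_to_perm.
Qed.

Hypothesis G_l : forall h x, h \in G -> x \in l -> actn h x \in l.

Lemma canon_leaf t T pre s : is_orbit_tree n tr l t T pre -> size s = t -> uniq s ->
  {subset s <= l} -> ~~ has (mem pre) s -> canon n t T s \in leaves t T.
Proof.
elim: t T pre s => [|t IHt] [|gs ch] pre [|x s] //= ok [st] /andP[xs us] sl.
rewrite negb_or => /andP[xpre spre].
have xl : x \in l by apply: sl; rewrite mem_head.
case: (followP n t gs ch x s) => [[i [p [ich Tx ->]]]|[no _]]; last first.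
  case/and3P: ok => _ /allP/(_ x xl) + _.
  rewrite (negbTE xpre) /=; move: no; rewrite /unzip1 -map_comp => /negbTE ->.
  by [].
have [ok' Gp vp px pre_p] := is_orbit_treeP ok ich Tx.
apply/flattenP; exists (map (cons (nth (0, Leaf) ch i).1) (leaves t (nth (0, Leaf) ch i).2)).
  by rewrite -(nth_map _ [::] (fun c => map (cons c.1) (leaves t c.2))) ?mem_nth ?size_map.
rewrite px map_f //; apply: IHt ok' _ _ _ _.
- by rewrite size_map.
- by rewrite map_inj_uniq //; exact: img_inj vp.
- move=> _ /mapP[y ys ->]; rewrite -(actn_to_perm _ vp) G_l // sl //.
  by rewrite inE ys orbT.
apply/hasPn => _ /mapP[y ys ->]; rewrite /= mem_rcons inE negb_or -{1}px.
rewrite (inj_eq (img_inj vp)) (contraNneq _ xs) => [|<- //] /=.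
apply: contra (hasPn spre y ys) => /= py.
by move: (pre_p _ py); rewrite actn_to_perm // => /(img_inj vp) <-.
Qed.

End Tree.

(** The case in which no exchange leaves the orbit: the order of the points is then
    irrelevant, and no increasing sequence has to be listed. *)
Definition all_swaps_fix n t T :=
  let f := canon n t T in
  all (fun i => all (fun r => f (swap i r) == r) (leaves t T)) (iota 0 t.-1).

(** [w] lists how many increasing sequences each representative has in its orbit.
    Each exchange must permute the representatives and preserve these numbers. *)
Definition swaps_balanced n l t T :=
  let f := canon n t T in
  let R := leaves t T in
  let L := map f (tsubs t l) in
  let w := [seq count_mem r L | r <- R] in
  all (fun i => let R' := [seq f (swap i r) | r <- R] in
    perm_eq R' R && ([seq nth 0 w (index r R) | r <- R'] == w)) (iota 0 t.-1).

(** The last condition is a conditional and not a disjunction, because a strict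
    evaluation of the latter would list the increasing sequences in all cases. *)
Definition certificate n (c : chain) l t T :=
  [&& uniq l, all (fun s => all (fun x => img s x \in l) l) (strong_gens c),
      is_orbit_tree n (transversals n c) l t T [::], uniq (leaves t T)
    & if all_swaps_fix n t T then true else swaps_balanced n l t T].

Section Bound.
Variables (n t : nat) (c : chain) (l : seq nat) (T : tree).
Hypotheses (c_strong : strong_chain n c) (c_T : certificate n c l t T).
Let G := generated n (strong_gens c).
Let f := canon n t T.

Let l_uniq : uniq l. Proof. by case/and5P: c_T. Qed.

Let c_valid : all (valid n) (strong_gens c). Proof. by case/andP: c_strong. Qed.

Let T_ok : is_orbit_tree n (transversals n c) l t T [::]. Proof. by case/and5P: c_T. Qed.

Let c_balanced : all_swaps_fix n t T \/ swaps_balanced n l t T.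
Proof. by case/and5P: c_T => _ _ _ _; case: ifP; [left | right]. Qed.

Lemma generated_stable h x : h \in G -> x \in l -> actn h x \in l.
Proof.
case/gen_prodgP=> m [k kS ->] xl.
apply: (big_ind (fun h : 'S_n => forall y, y \in l -> actn h y \in l)) (xl) => //.
- by move=> y; rewrite actn1.
- by move=> h1 h2 l1 l2 y yl; rewrite actnM l2 ?l1.
move=> i _ y yl; have := kS i; rewrite inE => /mapP[s sS ->].
rewrite actn_to_perm ?(allP c_valid) //.
by case/and5P: c_T => _ /allP/(_ s sS)/allP/(_ y yl).
Qed.

Lemma coverage_swap_tree i s : size s = t -> {subset s <= l} ->
  coverage G l (swap i s) = coverage G l s.
Proof.
move=> st sl; case: (leqP t.-1 i) => [ti|it]; first by rewrite swap_large ?st.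
have canonG s' : exists2 h, h \in G & f s' = map (actn h) s'.
  by have [h hG [_ E]] := canonP c_valid s' T_ok; exists h.
have R_uniq : uniq (leaves t T) by case/and5P: c_T.
have canonR u : u \in tsubs t l -> f u \in leaves t T.
  rewrite mem_tsubs => /andP[/eqP ut ul].
  apply: (canon_leaf c_valid generated_stable T_ok) => //; last by rewrite has_pred0.
    exact: subseq_uniq ul l_uniq.
  exact: mem_subseq.
apply: (coverage_swap l_uniq generated_stable canonG R_uniq canonR) => //.
  case: c_balanced => /allP/(_ i); rewrite mem_iota it => /(_ isT); last by case/andP.
  move/allP => fix_r.
  have /eq_in_map -> : {in leaves t T, (fun r => f (swap i r)) =1 id}.
    by move=> r rR; apply/eqP/fix_r.
  by rewrite map_id.
move=> r rR; case: c_balanced => /allP/(_ i); rewrite mem_iota it => /(_ isT).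
  by move/allP/(_ r rR)/eqP; rewrite /f => ->.
case/andP => /perm_mem RR /eqP/(congr1 (nth 0 ^~ (index r (leaves t T)))) /=.
have w_nth r' : r' \in leaves t T ->
    nth 0 [seq count_mem r [seq f u | u <- tsubs t l] | r <- leaves t T]
      (index r' (leaves t T)) = weight t l f r'.
  by move=> r'R; rewrite (nth_map [::]) ?index_mem // nth_index // count_map.
rewrite -/f w_nth // => <-; rewrite -map_comp (nth_map [::]) ?index_mem //=.
rewrite nth_index // w_nth // -RR; exact: (map_f (fun r => f (swap i r))).
Qed.

(** The invariance is known only for sequences inside [l]; [cov] extends the
    coverage by 0 to make it unconditional. *)
Lemma coverage_fact s : size s = t -> uniq s -> {subset s <= l} ->
  coverage G l s * t`! = #|G|.
Proof.
move=> st us sl; rewrite -(sum_coverage generated_stable us sl).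
rewrite (eq_big_seq (fun _ => coverage G l s)) => [|s'].
  by rewrite big_const_seq count_predT iter_addn_0 size_permutations // st mulnC.
rewrite mem_permutations => s's.
pose cov s1 := if all (mem l) s1 then coverage G l s1 else 0.
have covE s1 : {subset s1 <= l} -> cov s1 = coverage G l s1 by move=> /allP; rewrite /cov => ->.
rewrite -!covE // => [|x]; last by rewrite (perm_mem s's); apply: sl.
apply: (@eq_perm_swap _ _ cov t _ s' s _ s's) => [k s1 s1t|]; last by rewrite (perm_size s's).
rewrite /cov (perm_all _ (perm_swap k s1)); case: allP => // s1l.
exact: coverage_swap_tree.
Qed.

(** The first [v] points of [l] play the role of the symbols, and the rank of a
    symbol under [h] is the position of its image in [l]. *)
Lemma g_mul_fact_leq v : t <= v <= size l ->
  g v t * t`! <= \prod_(m <- orbit_sizes n c) m.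
Proof.
case/andP=> tv vl; apply: leq_trans (card_strong_chain c_strong); rewrite -/G.
pose pt (i : 'I_v) := nth 0 l i.
have ptl i : pt i \in l by rewrite mem_nth // (leq_trans (ltn_ord i)).
have pt_inj : injective pt.
  move=> i j /eqP; rewrite nth_uniq ?(leq_trans (ltn_ord _)) // => /eqP.
  exact: ord_inj.
pose rk (h : 'S_n) i := index (actn h (pt i)) l.
(* Outside G any injective rank function serves; only h in G are used. *)
pose rk' (h : 'S_n) : 'I_v -> nat := if h \in G then rk h else @nat_of_ord v.
have rk_inj h : injective (rk' h).
  rewrite /rk'; case: ifP => [hG i j E|_]; last exact: ord_inj.
  apply/pt_inj/(@actn_inj _ h).
  by rewrite -(nth_index 0 (generated_stable hG (ptl i))) [index _ _]E nth_index ?generated_stable.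
have E s : s \in dseqs v t -> coverage G l (map pt s) * t`! = #|G|.
  rewrite inE => us; apply: coverage_fact; rewrite ?size_map ?size_tuple ?map_inj_uniq //.
  by move=> _ /mapP[i _ ->].
have [s0d] : exists s : t.-tuple 'I_v, s \in dseqs v t.
  pose s1 : t.-tuple 'I_v := [tuple widen_ord tv i | i < t].
  exists s1; rewrite inE map_inj_uniq ?enum_uniq // => i j /(congr1 val) /= ij.
  exact: ord_inj.
move=> s0P; have E0 := E _ s0P; rewrite -E0 leq_mul2r; apply/orP; right.
have cov_gt0 : 0 < coverage G l (map pt s0d).
  by rewrite lt0n; apply: contraTneq (cardG_gt0 G) => c0; rewrite -E0 c0.
have cov s : s \in dseqs v t ->
    #|[set h in G | sorted (fun x y => rk' h x < rk' h y) (tval s)]|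
    = coverage G l (map pt s0d).
  move=> sd; have -> : coverage G l (map pt s0d) = coverage G l (map pt s).
    by apply/eqP; rewrite -(eqn_pmul2r (fact_gt0 t)) E0 E.
  apply: eq_card => h; rewrite !inE; case hG: (h \in G) => //=.
  rewrite /ordered_in -map_comp sorted_map; apply: eq_sorted => x y.
  by rewrite /rk' hG.
have [X X_P] := PSCA_of_ranks rk_inj cov.
exact: g_leq_PSCA X_P.
Qed.

End Bound.

(** * Mathieu groups and projective groups *)

Definition leaf_children (s : seq nat) := [seq (x, Leaf) | x <- s].

(** M24 with the points numbered so that 0, ..., 6 is a base.  The levels from 1 on
    form a chain of M23 and the levels from 2 on a chain of M22. *)
Definition M24_chain : chain := [::
  (0, [:: [:: 1; 3; 19; 4; 8; 17; 6; 10; 16; 22; 23; 11; 14; 21; 12; 7; 0; 15; 9; 2; 13; 20; 18; 5]]);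
  (1, [:: [:: 0; 2; 4; 11; 20; 23; 16; 19; 13; 22; 14; 9; 17; 12; 6; 8; 1; 10; 15; 3; 18; 7; 21; 5]]);
  (2, [:: [:: 0; 1; 14; 9; 4; 16; 7; 23; 22; 21; 15; 18; 3; 6; 10; 2; 5; 17; 11; 20; 8; 12; 19; 13]]);
  (3, [:: [:: 0; 1; 2; 7; 9; 20; 4; 16; 12; 5; 19; 6; 10; 18; 8; 11; 21; 3; 14; 13; 15; 23; 17; 22]]);
  (4, [:: [:: 0; 1; 2; 3; 21; 20; 10; 17; 23; 9; 6; 18; 12; 13; 22; 16; 15; 7; 11; 19; 5; 4; 14; 8]]);
  (5, [:: [:: 0; 1; 2; 3; 4; 9; 6; 21; 16; 5; 22; 20; 14; 17; 12; 15; 8; 13; 18; 23; 11; 7; 10; 19];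
     [:: 0; 1; 2; 3; 4; 13; 18; 14; 5; 7; 21; 11; 22; 8; 9; 6; 10; 12; 15; 20; 23; 16; 17; 19]]);
  (6, [:: [:: 0; 1; 2; 3; 4; 5; 18; 19; 13; 10; 22; 8; 21; 11; 17; 6; 7; 23; 15; 16; 12; 20; 9; 14]])].

(** The tree of M22 as the stabilizer of 0 and 1.  The child 5 of the stabilizer of
    0, ..., 4 stands for an orbit of 16 points; the child 6 stands for the three
    points that complete 0, ..., 4 to an octad. *)
Definition M22_tree : tree :=
  Node (strong_gens (drop 2 M24_chain))
  [:: (2, Node (strong_gens (drop 3 M24_chain))
     [:: (3, Node (strong_gens (drop 4 M24_chain))
        [:: (4, Node (strong_gens (drop 5 M24_chain))
           [:: (5, Node (strong_gens (drop 6 M24_chain))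
                (leaf_children [:: 6; 7; 8; 9; 12; 14]));
              (6, Node [:: [:: 0; 1; 2; 3; 4; 19; 6; 16; 21; 23; 20; 22; 17; 14; 13; 15; 7; 12; 18; 5; 10; 8; 11; 9];
                   [:: 0; 1; 2; 3; 4; 17; 6; 22; 20; 13; 21; 16; 19; 9; 23; 15; 11; 5; 18; 12; 8; 10; 7; 14];
                   [:: 0; 1; 2; 3; 4; 13; 6; 10; 11; 17; 7; 8; 23; 5; 19; 15; 20; 9; 18; 14; 16; 22; 21; 12];
                   [:: 0; 1; 2; 3; 4; 11; 6; 12; 13; 20; 23; 5; 7; 8; 21; 15; 17; 16; 18; 22; 9; 14; 19; 10]]
                (leaf_children [:: 5; 15; 18]))])])])].

Definition M23_tree : tree := Node (strong_gens (drop 1 M24_chain)) [:: (1, M22_tree)].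

Definition M24_tree : tree := Node (strong_gens M24_chain) [:: (0, M23_tree)].

(** This order balances the two kinds of five-point sets on which M22 does not
    induce the full symmetric group: the sets inside a hexad, with the alternating
    group, and sets that have a distinguished point, which must occur equally often
    in each of the five positions. *)
Definition M22_order := [:: 19; 12; 22; 6; 15; 17; 16; 21; 13; 23; 11; 18; 4; 8; 3; 5; 10; 7; 20; 2; 14; 9].

(** PGammaL(3,4), of order 120960, on the points of PG(2,4). *)
Definition PGammaL34_chain : chain := [::
  (0, [:: [:: 6; 19; 10; 7; 18; 12; 11; 2; 4; 1; 3; 9; 14; 5; 16; 15; 8; 20; 13; 17; 0]]);
  (1, [:: [:: 0; 9; 7; 15; 6; 12; 20; 3; 5; 11; 2; 8; 16; 17; 13; 10; 14; 4; 19; 1; 18]]);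
  (2, [:: [:: 0; 1; 10; 14; 12; 11; 5; 8; 7; 19; 17; 16; 15; 18; 6; 4; 3; 20; 13; 2; 9]]);
  (3, [:: [:: 0; 1; 2; 6; 15; 10; 3; 13; 8; 17; 5; 11; 12; 7; 20; 4; 19; 9; 18; 16; 14];
     [:: 0; 1; 2; 7; 12; 8; 16; 3; 5; 9; 10; 14; 4; 19; 11; 15; 6; 18; 17; 13; 20]]);
  (4, [:: [:: 0; 1; 2; 3; 12; 19; 8; 10; 6; 18; 7; 11; 4; 16; 20; 15; 13; 17; 9; 5; 14]])].

Definition PGammaL34_tree : tree :=
  Node (strong_gens PGammaL34_chain)
  [:: (0, Node (strong_gens (drop 1 PGammaL34_chain))
     [:: (1, Node (strong_gens (drop 2 PGammaL34_chain))
        [:: (2, Node (strong_gens (drop 3 PGammaL34_chain))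
             (leaf_children [:: 3; 4; 9; 11]));
           (4, Node [:: [:: 0; 1; 7; 20; 4; 11; 19; 6; 10; 5; 17; 13; 15; 9; 8; 12; 3; 14; 16; 2; 18];
                [:: 0; 1; 19; 2; 4; 11; 9; 8; 18; 10; 16; 17; 15; 7; 3; 12; 6; 20; 13; 14; 5]]
             (leaf_children [:: 2; 12]))])])].

(** Only the sets of three collinear points and a fourth point off their line need
    care: the fourth point must occur equally often in each of the four positions. *)
Definition PGammaL34_order := [:: 5; 3; 16; 6; 1; 14; 12; 9; 15; 18; 11; 0; 7; 4; 8; 20; 2; 13; 17; 19; 10].

(** M12, sharply 5-transitive; the levels from 1 on form a chain of M11. *)
Definition M12_chain : chain := [::
  (0, [:: [:: 1; 11; 5; 10; 3; 9; 8; 7; 6; 4; 2; 0]]);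
  (1, [:: [:: 0; 10; 6; 3; 9; 4; 11; 1; 8; 5; 7; 2]]);
  (2, [:: [:: 0; 1; 6; 5; 8; 3; 2; 11; 4; 9; 10; 7]]);
  (3, [:: [:: 0; 1; 2; 7; 4; 8; 5; 10; 9; 6; 11; 3]]);
  (4, [:: [:: 0; 1; 2; 3; 5; 10; 9; 11; 4; 7; 8; 6];
     [:: 0; 1; 2; 3; 7; 9; 4; 10; 11; 8; 6; 5]])].

Definition M11_tree : tree :=
  Node (strong_gens (drop 1 M12_chain))
  [:: (1, Node (strong_gens (drop 2 M12_chain))
     [:: (2, Node (strong_gens (drop 3 M12_chain))
        [:: (3, Node (strong_gens (drop 4 M12_chain))
           [:: (4, Node [::]
                (leaf_children [:: 5; 6; 7; 8; 9; 10; 11]))])])])].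

Definition M12_tree : tree := Node (strong_gens M12_chain) [:: (0, M11_tree)].

(** The six-point sets that are not hexads of S(5,6,12) have a stabilizer that
    induces only PGL(2,5), of index 6 in the symmetric group; the six orbits of
    sequences over these sets must contain equally many increasing ones. *)
Definition M12_order := [:: 11; 5; 7; 0; 1; 2; 8; 9; 6; 4; 3; 10].

(** The same condition for the five-point sets that are not blocks of S(4,5,11), on
    which M11 induces a group of order 20, again of index 6. *)
Definition M11_order := [:: 2; 4; 5; 7; 10; 9; 1; 8; 3; 11; 6].

(** PSL(3,3) on the points of PG(2,3), with a base that is a frame; the levels from
    1 on form a chain of the stabilizer of the point 0, of order 432. *)
Definition L33_chain : chain := [::
  (0, [:: [:: 3; 7; 0; 4; 5; 10; 8; 9; 2; 12; 6; 11; 1]]);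
  (1, [:: [:: 0; 2; 5; 8; 6; 7; 1; 4; 9; 3; 11; 10; 12]]);
  (2, [:: [:: 0; 1; 11; 2; 5; 4; 10; 12; 6; 7; 3; 8; 9]]);
  (3, [:: [:: 0; 1; 2; 11; 5; 4; 6; 7; 10; 12; 8; 3; 9];
     [:: 0; 1; 2; 12; 4; 5; 7; 6; 10; 11; 8; 9; 3]])].

Definition L33_point_tree : tree :=
  Node (strong_gens (drop 1 L33_chain))
  [:: (1, Node (strong_gens (drop 2 L33_chain))
     [:: (2, Node (strong_gens (drop 3 L33_chain))
        [:: (3, Node [::]
             (leaf_children [:: 4; 5; 6; 7; 8; 9; 10; 11; 12]));
           (4, Node [:: [:: 0; 1; 2; 12; 4; 5; 7; 6; 10; 11; 8; 9; 3]]
             (leaf_children [:: 3; 5; 6; 8; 9]));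
           (6, Node [:: [:: 0; 1; 2; 11; 5; 4; 6; 7; 10; 12; 8; 3; 9]]
             (leaf_children [:: 3; 4; 7; 8; 9]));
           (8, Node [:: [:: 0; 1; 2; 9; 5; 4; 7; 6; 8; 3; 10; 12; 11]]
             (leaf_children [:: 3; 4; 6; 10; 11]))]);
        (4, Node [:: [:: 0; 1; 7; 8; 4; 5; 2; 6; 9; 3; 12; 10; 11];
             [:: 0; 1; 9; 10; 4; 5; 8; 3; 12; 11; 7; 2; 6];
             [:: 0; 1; 12; 3; 4; 5; 11; 10; 9; 8; 7; 6; 2]]
        [:: (2, Node [:: [:: 0; 1; 2; 12; 4; 5; 7; 6; 10; 11; 8; 9; 3]]
             (leaf_children [:: 3; 5; 6; 8; 9]));
           (5, Node [:: [:: 0; 1; 3; 2; 4; 5; 8; 9; 6; 7; 11; 10; 12];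
                [:: 0; 1; 9; 10; 4; 5; 8; 3; 12; 11; 7; 2; 6];
                [:: 0; 1; 6; 9; 4; 5; 7; 2; 3; 8; 11; 12; 10]]
             (leaf_children [:: 2]))])])].

Definition L33_tree : tree := Node (strong_gens L33_chain) [:: (0, L33_point_tree)].

(** As for PGammaL(3,4), a point off the line of three collinear ones must occur
    equally often in each position. *)
Definition L33_order := [:: 8; 7; 1; 2; 12; 0; 3; 9; 10; 5; 6; 11; 4].

(** The point stabilizer has several orbits of four-point sets, most of them with a
    small induced group; this order balances all of them at once. *)
Definition L33_point_order := [:: 2; 10; 11; 8; 7; 5; 12; 1; 4; 3; 6; 9].

Lemma M24_strong : strong_chain 24 M24_chain. Proof. by vm_compute. Qed.

Lemma PGammaL34_strong : strong_chain 21 PGammaL34_chain. Proof. by vm_compute. Qed.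

Lemma M12_strong : strong_chain 12 M12_chain. Proof. by vm_compute. Qed.

Lemma L33_strong : strong_chain 13 L33_chain. Proof. by vm_compute. Qed.

Lemma M24_orbit_sizes : orbit_sizes 24 M24_chain = [:: 24; 23; 22; 21; 20; 16; 3].
Proof. by vm_compute. Qed.

Lemma PGammaL34_orbit_sizes : orbit_sizes 21 PGammaL34_chain = [:: 21; 20; 16; 9; 2].
Proof. by vm_compute. Qed.

Lemma M12_orbit_sizes : orbit_sizes 12 M12_chain = [:: 12; 11; 10; 9; 8].
Proof. by vm_compute. Qed.

Lemma L33_orbit_sizes : orbit_sizes 13 L33_chain = [:: 13; 12; 9; 4].
Proof. by vm_compute. Qed.

Lemma orbit_sizes_drop n k c : orbit_sizes n (drop k c) = drop k (orbit_sizes n c).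
Proof. by elim: c k => [|[b gs] c IHc] [|k] //=; apply: IHc. Qed.

Lemma M24_certificate :
  all (fun t => certificate 24 M24_chain (iota 0 24) t M24_tree) [:: 4; 5; 6].
Proof. by vm_compute. Qed.

Lemma M23_certificate :
  all (fun t => certificate 24 (drop 1 M24_chain) (iota 1 23) t M23_tree) [:: 4; 5].
Proof. by vm_compute. Qed.

Lemma M22_certificate :
  all (fun t => certificate 24 (drop 2 M24_chain) M22_order t M22_tree) [:: 4; 5].
Proof. by vm_compute. Qed.

Lemma PGammaL34_certificate :
  certificate 21 PGammaL34_chain PGammaL34_order 4 PGammaL34_tree.
Proof. by vm_compute. Qed.

Lemma M12_certificate :
  all (fun t => certificate 12 M12_chain M12_order t M12_tree) [:: 5; 6].
Proof. by vm_compute. Qed.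

Lemma M11_certificate : certificate 12 (drop 1 M12_chain) M11_order 5 M11_tree.
Proof. by vm_compute. Qed.

Lemma L33_certificate : certificate 13 L33_chain L33_order 4 L33_tree.
Proof. by vm_compute. Qed.

Lemma L33_point_certificate :
  certificate 13 (drop 1 L33_chain) L33_point_order 4 L33_point_tree.
Proof. by vm_compute. Qed.

(** * The upper bounds *)

Lemma M24_bound v t : t \in [:: 4; 5; 6] -> t <= v <= 24 ->
  g v t * t`! <= \prod_(m <- [:: 24; 23; 22; 21; 20; 16; 3]) m.
Proof.
by move=> /(allP M24_certificate)/(g_mul_fact_leq M24_strong)/[apply]; rewrite M24_orbit_sizes.
Qed.

Lemma M23_bound v t : t \in [:: 4; 5] -> t <= v <= 23 ->
  g v t * t`! <= \prod_(m <- [:: 23; 22; 21; 20; 16; 3]) m.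
Proof.
move=> /(allP M23_certificate)/(g_mul_fact_leq (strong_chain_drop 1 M24_strong))/[apply].
by rewrite orbit_sizes_drop M24_orbit_sizes.
Qed.

Lemma M22_bound v t : t \in [:: 4; 5] -> t <= v <= 22 ->
  g v t * t`! <= \prod_(m <- [:: 22; 21; 20; 16; 3]) m.
Proof.
move=> /(allP M22_certificate)/(g_mul_fact_leq (strong_chain_drop 2 M24_strong))/[apply].
by rewrite orbit_sizes_drop M24_orbit_sizes.
Qed.

Lemma PGammaL34_bound v : 4 <= v <= 21 ->
  g v 4 * 4`! <= \prod_(m <- [:: 21; 20; 16; 9; 2]) m.
Proof.
by move/(g_mul_fact_leq PGammaL34_strong PGammaL34_certificate); rewrite PGammaL34_orbit_sizes.
Qed.

Lemma M12_bound v t : t \in [:: 5; 6] -> t <= v <= 12 ->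
  g v t * t`! <= \prod_(m <- [:: 12; 11; 10; 9; 8]) m.
Proof.
by move=> /(allP M12_certificate)/(g_mul_fact_leq M12_strong)/[apply]; rewrite M12_orbit_sizes.
Qed.

Lemma M11_bound v : 5 <= v <= 11 ->
  g v 5 * 5`! <= \prod_(m <- [:: 11; 10; 9; 8]) m.
Proof.
move/(g_mul_fact_leq (strong_chain_drop 1 M12_strong) M11_certificate).
by rewrite orbit_sizes_drop M12_orbit_sizes.
Qed.

Lemma L33_bound v : 4 <= v <= 13 ->
  g v 4 * 4`! <= \prod_(m <- [:: 13; 12; 9; 4]) m.
Proof. by move/(g_mul_fact_leq L33_strong L33_certificate); rewrite L33_orbit_sizes. Qed.

Lemma L33_point_bound v : 4 <= v <= 12 ->
  g v 4 * 4`! <= \prod_(m <- [:: 12; 9; 4]) m.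
Proof.
move/(g_mul_fact_leq (strong_chain_drop 1 L33_strong) L33_point_certificate).
by rewrite orbit_sizes_drop L33_orbit_sizes.
Qed.

(** Large literals are decimal constants.  They are expanded to their Horner form,
    where [lia] sees products and sums of small numbers and no unary number of that
    size is ever built. *)
Ltac divide_by_factorial :=
  rewrite !factS fact0 !big_cons big_nil;
  cbn [Nat.of_num_uint Nat.of_uint Nat.of_uint_acc];
  rewrite ?PeanoNat.Nat.tail_mul_spec; lia.

Theorem theorem4p7 :
  [/\ forall v : nat, v <= 11 -> (5 <= v -> g v 5 <= 66),
      forall v : nat, v <= 12 ->
        [/\ 4 <= v -> g v 4 <= 18,
            5 <= v -> g v 5 <= 792
          & 6 <= v -> g v 6 <= 132],
      forall v : nat, v <= 13 -> (4 <= v -> g v 4 <= 234),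
      forall v : nat, v <= 21 -> (4 <= v -> g v 4 <= 5040)
    & [/\ forall v : nat, v <= 22 ->
            (5 <= v -> g v 5 <= 3696) /\ (4 <= v -> g v 4 <= 18480),
          forall v : nat, v <= 23 ->
            (5 <= v -> g v 5 <= 85008) /\ (4 <= v -> g v 4 <= 425040)
        & forall v : nat, v <= 24 ->
            [/\ 6 <= v -> g v 6 <= 340032,
                5 <= v -> g v 5 <= 2040192
              & 4 <= v -> g v 4 <= 10200960]]].
Proof.
split=> [v v11 v5|v v12|v v13 v4|v v21 v4|].
- by have := @M11_bound v; rewrite v5 v11 => /(_ isT); divide_by_factorial.
- split=> vt.
  + by have := @L33_point_bound v; rewrite vt v12 => /(_ isT); divide_by_factorial.
  + by have := @M12_bound v 5 isT; rewrite vt v12 => /(_ isT); divide_by_factorial.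
  + by have := @M12_bound v 6 isT; rewrite vt v12 => /(_ isT); divide_by_factorial.
- by have := @L33_bound v; rewrite v4 v13 => /(_ isT); divide_by_factorial.
- by have := @PGammaL34_bound v; rewrite v4 v21 => /(_ isT); divide_by_factorial.
split=> v vn; split=> vt.
- by have := @M22_bound v 5 isT; rewrite vt vn => /(_ isT); divide_by_factorial.
- by have := @M22_bound v 4 isT; rewrite vt vn => /(_ isT); divide_by_factorial.
- by have := @M23_bound v 5 isT; rewrite vt vn => /(_ isT); divide_by_factorial.
- by have := @M23_bound v 4 isT; rewrite vt vn => /(_ isT); divide_by_factorial.
- by have := @M24_bound v 6 isT; rewrite vt vn => /(_ isT); divide_by_factorial.
- by have := @M24_bound v 5 isT; rewrite vt vn => /(_ isT); divide_by_factorial.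
- by have := @M24_bound v 4 isT; rewrite vt vn => /(_ isT); divide_by_factorial.
Qed.
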